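(* Let $TG$ be a type graph, $T$ a graph typed over $TG$, and $\mathcal C$ a set of conditions in $\mathbf{Sub}(T)$. Then there is a set $\mathcal C^{\mathrm{NF}}$ of conditions in $\mathbf{Sub}(T)$ such that (i) all conditions from $\mathcal C^{\mathrm{NF}}$ are Boolean combinations of literals over $\mathbf{Sub}(T)$ and are all in the same normal form known from propositional logic (e.g., conjunctive normal form or disjunctive normal form), and (ii) there is a function $j\colon\mathcal C\to\mathcal C^{\mathrm{NF}}$ such that for every $c\in\mathcal C$ and every $S\in\mathbf{Sub}(T)$ $$\iota^{B_0}_S\models_{\mathcal I} c\iff \iota^{B_0}_S\models_{\mathcal I} j(c),$$ where $B_0$ is the graph over which the condition $c$ is defined and $\iota^{B_0}_S\colon B_0\subseteq S$ is the inclusion.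
   Context: **Graphs.** A graph $G=(V_G,E_G,\mathit{src}_G,\mathit{tar}_G)$ consists of a set of nodes, a set of edges, and source and target functions $E_G\to V_G$; graph morphisms are pairs of functions on nodes and edges compatible with source and target. A type graph $TG$ is a fixed graph; a graph typed over $TG$ is a graph $G$ with a graph morphism $\mathit{type}_G\colon G\to TG$. A subgraph $H\subseteq G$ of a typed graph $G$ has $V_H\subseteq V_G$, $E_H\subseteq E_G$, with $\mathit{src}_H,\mathit{tar}_H,\mathit{type}_H$ the restrictions of those of $G$. **Category $\mathbf{Sub}(T)$.** Objects are the subgraphs $G\subseteq T$; morphisms are the inclusions between such subgraphs. **Conditions in $\mathbf{Sub}(T)$.** Conditions over an object $B_0$ are defined recursively: $\mathsf{true}$ is a condition over $B_0$; if $b_1\colon B_0\subseteq B_1$ is a morphism in $\mathbf{Sub}(T)$ and $d$ is a condition over $B_1$, then $\exists\,(b_1\colon B_0\subseteq B_1, d)$ is a condition over $B_0$; (finite) Boolean combinations (via $\neg,\wedge,\vee$) of conditions over $B_0$ are conditions over $B_0$. $\mathsf{false}$ denotes $\neg\mathsf{true}$. **Satisfaction $\models_{\mathcal I}$ in $\mathbf{Sub}(T)$.** Let $\iota^{B_0}_G\colon B_0\subseteq G$ be an inclusion with $G\in\mathbf{Sub}(T)$. Every such inclusion satisfies $\mathsf{true}$; $\iota^{B_0}_G\models_{\mathcal I}\exists\,(b_1\colon B_0\subseteq B_1,d)$ iff there is an inclusion $\iota^{B_1}_G\colon B_1\subseteq G$ (necessarily with $\iota^{B_1}_G\circ b_1=\iota^{B_0}_G$)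 such that $\iota^{B_1}_G\models_{\mathcal I} d$; Boolean operators are interpreted as usual. The equivalence in (ii) concerns those $S$ for which the inclusion $B_0\subseteq S$ exists, and $j(c)$ is a condition over the same graph $B_0$ as $c$. **Literals.** A literal in $\mathbf{Sub}(T)$ is a condition of the form $\mathsf{true}$, $\mathsf{false}$, $\exists\,(b\colon B_0\subseteq B_1,\mathsf{true})$ or $\neg\exists\,(b\colon B_0\subseteq B_1,\mathsf{true})$ with $B_0,B_1\in\mathbf{Sub}(T)$. A Boolean combination of literals is in a propositional normal form if it is so when these literals play the role of propositional literals: e.g., conjunctive normal form means a conjunction of disjunctions of literals, disjunctive normal form a disjunction of conjunctions of literals. *)

(* Defs.v *)
From mathcomp Require Import all_boot.
From mathcomp Require Export classical_sets.
Set Implicit Arguments.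
Unset Strict Implicit.
Unset Printing Implicit Defensive.
Local Open Scope classical_set_scope.

Record graph := Graph {
  node : Type;
  edge : Type;
  src : edge -> node;
  tar : edge -> node }.

Record graph_morphism (G H : graph) := GraphMorphism {
  on_node : node G -> node H;
  on_edge : edge G -> edge H;
  on_src : forall e, src (on_edge e) = on_node (src e);
  on_tar : forall e, tar (on_edge e) = on_node (tar e) }.

Record typed_graph (TG : graph) := TypedGraph {
  untyped :> graph;
  typing : graph_morphism untyped TG }.

(* The source, target and typing functions of a subgraph are the restrictions
   of those of G, so a subgraph is determined by a set of nodes and a set of
   edges, subject only to src and tar restricting to them. *)
Record subgraph (TG : graph) (G : typed_graph TG) := Subgraph {
  nodes : set (node G);
  edges : set (edge G);
  src_nodes : forall e, edges e -> nodes (src e);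
  tar_nodes : forall e, edges e -> nodes (tar e) }.

(* There is at most one inclusion between two subgraphs of T, so the
   morphisms of Sub(T) are taken as proofs of a proposition. *)
Definition inclusion TG (T : typed_graph TG) (A B : subgraph T) : Prop :=
  nodes A `<=` nodes B /\ edges A `<=` edges B.

Inductive condition TG (T : typed_graph TG) (B0 : subgraph T) : Type :=
| CTrue
| CExists (B1 : subgraph T) (b1 : inclusion B0 B1) (d : condition B1)
| CNot (c : condition B0)
| CAnd (c d : condition B0)
| COr (c d : condition B0).

Arguments CTrue {TG T B0}.

Definition CFalse TG (T : typed_graph TG) (B0 : subgraph T) : condition B0 :=
  CNot CTrue.

Arguments CFalse {TG T B0}.

(* The equation i1 o b1 = i between inclusions holds automatically. *)
Fixpoint satisfies TG (T : typed_graph TG) (B0 S : subgraph T)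
    (i : inclusion B0 S) (c : condition B0) {struct c} : Prop :=
  match c with
  | CTrue => True
  | CExists B1 _ d => exists i1 : inclusion B1 S, satisfies i1 d
  | CNot c1 => ~ satisfies i c1
  | CAnd c1 c2 => satisfies i c1 /\ satisfies i c2
  | COr c1 c2 => satisfies i c1 \/ satisfies i c2
  end.

(* A condition in Sub(T), over an arbitrary base graph. *)
Record sub_condition TG (T : typed_graph TG) := SubCondition {
  base : subgraph T;
  cond : condition base }.

Section NormalForms.
Variables (TG : graph) (T : typed_graph TG) (B0 : subgraph T).
Implicit Types (P : set (condition B0)) (c d : condition B0).

Inductive literal : set (condition B0) :=
| literal_true : literal CTrue
| literal_false : literal CFalse
| literal_exists B1 (b : inclusion B0 B1) : literal (CExists b CTrue)
| literal_nexists B1 (b : inclusion B0 B1) : literal (CNot (CExists b CTrue)).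

Inductive boolean_combination P : set (condition B0) :=
| bool_atom c : P c -> boolean_combination P c
| bool_not c : boolean_combination P c -> boolean_combination P (CNot c)
| bool_and c d : boolean_combination P c -> boolean_combination P d ->
    boolean_combination P (CAnd c d)
| bool_or c d : boolean_combination P c -> boolean_combination P d ->
    boolean_combination P (COr c d).

(* Conjunctions and disjunctions are finite, nonempty and arbitrarily
   bracketed; the empty ones are available as the literals true and false. *)
Inductive conjunction_of P : set (condition B0) :=
| conj_one c : P c -> conjunction_of P c
| conj_and c d : conjunction_of P c -> conjunction_of P d ->
    conjunction_of P (CAnd c d).

Inductive disjunction_of P : set (condition B0) :=
| disj_one c : P c -> disjunction_of P c
| disj_or c d : disjunction_of P c -> disjunction_of P d ->
    disjunction_of P (COr c d).

End NormalForms.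

Variant normal_form := CNF | DNF.

Definition in_normal_form (nf : normal_form) TG (T : typed_graph TG)
    (B0 : subgraph T) : set (condition B0) :=
  match nf with
  | CNF => conjunction_of (disjunction_of (@literal TG T B0))
  | DNF => disjunction_of (conjunction_of (@literal TG T B0))
  end.

(* Main.v *)
Require Import Defs.
From mathcomp Require Import all_boot boolp classical_sets.

(** Between two subgraphs of [T] there is at most one inclusion, so nested
    quantifiers carry no binding information: an inclusion B0 <= S satisfies
    [exists (B0 <= B1, d)] precisely when B1 <= S and B1 <= S satisfies [d].
    The inner condition [d] can moreover be re-based from B1 to B0, because
    each of its existential atoms only asks whether some larger subgraph is
    contained in S, and that question does not depend on the base.  Hence
    [exists (B0 <= B1, d)] is equivalent to [exists (B0 <= B1, true)] and [d]
    re-based to B0, and recursively every condition is equivalent to a Boolean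
    combination of literals ([flatten], [satisfies_flatten]).

    What remains is propositional logic ([boolean_combination_dnf]): by
    induction, both the combination and its negation have a disjunctive normal
    form.  Keeping track of the negation makes the induction go through, with
    the distributive law as its only real step, and it also gives the
    conjunctive normal form for free, by pushing a negation through the
    disjunctive normal form of the negated condition ([dnf_not_cnf]). *)

Set Implicit Arguments.
Unset Strict Implicit.
Unset Printing Implicit Defensive.
Local Open Scope classical_set_scope.

Section Flattening.
Variables (TG : graph) (T : typed_graph TG).

Lemma inclusion_refl (A : subgraph T) : inclusion A A.
Proof. by split. Qed.

Lemma inclusion_trans (A B C : subgraph T) :
  inclusion A B -> inclusion B C -> inclusion A C.
Proof.
by move=> [nAB eAB] [nBC eBC]; split; [exact: subset_trans nBC|exact: subset_trans eBC].
Qed.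

(** The base of the result is a smaller subgraph [B0] rather than the base [B]
    of the condition, so that the recursive call under a quantifier can keep
    [B0] fixed while the base of the condition grows. *)
Fixpoint flatten (B0 B : subgraph T) (b : inclusion B0 B) (c : condition B) :
    condition B0 :=
  match c with
  | CTrue => CTrue
  | CExists B1 b1 d =>
      let b01 := inclusion_trans b b1 in CAnd (CExists b01 CTrue) (flatten b01 d)
  | CNot c1 => CNot (flatten b c1)
  | CAnd c1 c2 => CAnd (flatten b c1) (flatten b c2)
  | COr c1 c2 => COr (flatten b c1) (flatten b c2)
  end.

Lemma flatten_boolean_combination (B0 B : subgraph T) (b : inclusion B0 B)
    (c : condition B) :
  boolean_combination (@literal TG T B0) (flatten b c).
Proof.
elim: c B0 b => {B} /=.
- by move=> B B0 b; apply/bool_atom/literal_true.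
- move=> B B1 b1 d IHd B0 b; apply: bool_and; last exact: IHd.
  exact/bool_atom/literal_exists.
- by move=> B c IHc B0 b; apply: bool_not.
- by move=> B c IHc d IHd B0 b; apply: bool_and.
- by move=> B c IHc d IHd B0 b; apply: bool_or.
Qed.

(** The two sides can only agree on those [S] that contain the old base [B]:
    on a smaller [S] the condition [c] has no meaning.  Under a quantifier this
    restriction is harmless, since the added conjunct forces [S] to contain
    the quantified subgraph. *)
Lemma satisfies_flatten (B0 B S : subgraph T) (b : inclusion B0 B)
    (c : condition B) (i0 : inclusion B0 S) (i : inclusion B S) :
  satisfies i0 (flatten b c) <-> satisfies i c.
Proof.
elim: c B0 b i0 i => {B} //=.
- move=> B B1 b1 d IHd B0 b i0 i; split=> [[[i1 _] sd]|[i1 sd]].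
    by exists i1; exact: (IHd _ _ i0 i1).1 sd.
  by split; [exists i1|exact: (IHd _ _ i0 i1).2 sd].
- by move=> B c IHc B0 b i0 i; rewrite (IHc _ b i0 i).
- by move=> B c IHc d IHd B0 b i0 i; rewrite (IHc _ b i0 i) (IHd _ b i0 i).
- by move=> B c IHc d IHd B0 b i0 i; rewrite (IHc _ b i0 i) (IHd _ b i0 i).
Qed.

End Flattening.

Section PropositionalNormalForms.
Variables (TG : graph) (T : typed_graph TG) (B0 : subgraph T).
Implicit Types (P Q : set (condition B0)) (c d : condition B0).

Definition equivalent c d :=
  forall (S : subgraph T) (i : inclusion B0 S), satisfies i c <-> satisfies i d.

Definition has_normal_form nf c :=
  exists2 d, in_normal_form nf d & equivalent c d.

Lemma equivalent_has_normal_form nf c d :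
  equivalent c d -> has_normal_form nf d -> has_normal_form nf c.
Proof. by move=> cd [e nfe de]; exists e => // S i; rewrite cd. Qed.

Lemma conjunction_of_boolean_combination P Q :
  P `<=` boolean_combination Q -> conjunction_of P `<=` boolean_combination Q.
Proof.
move=> PQ c; elim=> [d /PQ//|c1 c2 _ Qc1 _ Qc2].
exact: bool_and.
Qed.

Lemma disjunction_of_boolean_combination P Q :
  P `<=` boolean_combination Q -> disjunction_of P `<=` boolean_combination Q.
Proof.
move=> PQ c; elim=> [d /PQ//|c1 c2 _ Qc1 _ Qc2].
exact: bool_or.
Qed.

Lemma in_normal_form_boolean_combination nf :
  @in_normal_form nf TG T B0 `<=` boolean_combination (@literal TG T B0).
Proof.
have litP : @literal TG T B0 `<=` boolean_combination (@literal TG T B0).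
  by move=> c; apply: bool_atom.
case: nf => /=.
- exact/conjunction_of_boolean_combination/disjunction_of_boolean_combination.
- exact/disjunction_of_boolean_combination/conjunction_of_boolean_combination.
Qed.

Lemma literal_not c :
  literal c -> exists2 d, literal d & equivalent (CNot c) d.
Proof.
case=> [||B1 b|B1 b].
- by exists CFalse; first exact: literal_false.
- exists CTrue; first exact: literal_true.
  by move=> S i /=; split=> // _; apply.
- by exists (CNot (CExists b CTrue)); first exact: literal_nexists.
- exists (CExists b CTrue); first exact: literal_exists.
  by move=> S i /=; rewrite not_notP.
Qed.

Lemma literal_dnf c : literal c -> has_normal_form DNF c.
Proof. by move=> lc; exists c => //; apply/disj_one/conj_one. Qed.

Lemma dnf_or c d :
  has_normal_form DNF c -> has_normal_form DNF d -> has_normal_form DNF (COr c d).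
Proof.
move=> [c' nfc cc'] [d' nfd dd']; exists (COr c' d'); first exact: disj_or.
by move=> S i /=; rewrite cc' dd'.
Qed.

(** Distributivity of conjunction over disjunction, first in the left and then
    in the right argument; at the leaves the conjunction of two conjunctions of
    literals is again one. *)
Lemma dnf_and c d :
  has_normal_form DNF c -> has_normal_form DNF d -> has_normal_form DNF (CAnd c d).
Proof.
move=> [c' nfc cc'] [d' nfd dd'].
apply: (@equivalent_has_normal_form _ _ (CAnd c' d')).
  by move=> S i /=; rewrite cc' dd'.
elim: nfc => {c c' cc'} [c conj_c|c1 c2 _ IH1 _ IH2]; last first.
  apply: equivalent_has_normal_form (dnf_or IH1 IH2) => S i /=; tauto.
elim: nfd => {d d' dd'} [d conj_d|d1 d2 _ IH1 _ IH2]; last first.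
  apply: equivalent_has_normal_form (dnf_or IH1 IH2) => S i /=; tauto.
by exists (CAnd c d) => //; apply/disj_one/conj_and.
Qed.

Lemma conjunction_not c :
  conjunction_of (@literal TG T B0) c ->
  exists2 d, disjunction_of (@literal TG T B0) d & equivalent (CNot c) d.
Proof.
elim=> {c} [c /literal_not[d ld cd]|c1 c2 _ [d1 ld1 cd1] _ [d2 ld2 cd2]].
  by exists d => //; apply: disj_one.
exists (COr d1 d2); first exact: disj_or.
by move=> S i /=; rewrite not_andP -cd1 -cd2.
Qed.

(** De Morgan's laws, applied at both levels, end in negated literals, which
    are equivalent to literals. *)
Lemma dnf_not_cnf c : has_normal_form DNF c -> has_normal_form CNF (CNot c).
Proof.
move=> [c' nfc cc'].
apply: (@equivalent_has_normal_form _ _ (CNot c')).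
  by move=> S i /=; rewrite cc'.
elim: nfc => {c c' cc'} [c /conjunction_not[d ld cd]|].
  by exists d => //; apply: conj_one.
move=> c1 c2 _ [d1 nfd1 cd1] _ [d2 nfd2 cd2].
exists (CAnd d1 d2); first exact: conj_and.
by move=> S i /=; rewrite not_orP -cd1 -cd2.
Qed.

(** The negation of a disjunctive normal form is not one, so the claim about
    [c] alone is not inductive; with both claims together, a negation just
    swaps them, and the other connectives use [dnf_and] on one side and
    [dnf_or] on the other. *)
Lemma boolean_combination_dnf c :
  boolean_combination (@literal TG T B0) c ->
  has_normal_form DNF c /\ has_normal_form DNF (CNot c).
Proof.
elim=> {c} [c lc|c _ [nfc nfNc]|c d _ [nfc nfNc] _ [nfd nfNd]
           |c d _ [nfc nfNc] _ [nfd nfNd]].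
- split; first exact: literal_dnf.
  have [d ld cd] := literal_not lc.
  exact: equivalent_has_normal_form cd (literal_dnf ld).
- split=> //; apply: equivalent_has_normal_form nfc => S i /=.
  exact: not_notP.
- split; first exact: dnf_and.
  apply: equivalent_has_normal_form (dnf_or nfNc nfNd) => S i /=.
  exact: not_andP.
- split; first exact: dnf_or.
  apply: equivalent_has_normal_form (dnf_and nfNc nfNd) => S i /=.
  exact: not_orP.
Qed.

Lemma boolean_combination_normal_form nf c :
  boolean_combination (@literal TG T B0) c -> has_normal_form nf c.
Proof.
move=> /boolean_combination_dnf[nfc nfNc]; case: nf => //.
apply: equivalent_has_normal_form (dnf_not_cnf nfNc) => S i /=.
by rewrite not_notP.
Qed.

Lemma condition_normal_form nf c : has_normal_form nf c.
Proof.
have b := inclusion_refl B0.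
apply: (@equivalent_has_normal_form _ _ (flatten b c)).
  by move=> S i; rewrite (satisfies_flatten b c i i).
exact/boolean_combination_normal_form/flatten_boolean_combination.
Qed.

End PropositionalNormalForms.

Theorem corollary4 (TG : graph) (T : typed_graph TG)
    (C : set (sub_condition T)) (nf : normal_form) :
  exists C_NF : set (sub_condition T),
    (forall c : sub_condition T, C_NF c ->
       boolean_combination (@literal TG T (base c)) (cond c) /\
       in_normal_form nf (cond c)) /\
    (exists j : C -> C_NF, forall c : C,
       base (sval (j c)) = base (sval c) /\
       forall (S : subgraph T) (i : inclusion (base (sval c)) S)
              (i' : inclusion (base (sval (j c))) S),
         satisfies i (cond (sval c)) <-> satisfies i' (cond (sval (j c)))).
Proof.
exists [set c | in_normal_form nf (cond c)]; split=> [c nfc|].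
  by split=> //; apply: in_normal_form_boolean_combination nfc.
pose nf_of (c : sub_condition T) := cid2 (condition_normal_form nf (cond c)).
exists (fun c => exist _ (SubCondition (s2val (nf_of (sval c))))
                         (mem_set (s2valP (nf_of (sval c))))).
move=> c; split=> // S i i' /=.
by rewrite (Prop_irrelevance i' i); apply: (s2valP' (nf_of (sval c))).
Qed.
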